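(* For any positive integer $t\geq 1$, there exist real numbers $\alpha,\beta$ and a $2$-walk $(\alpha,\beta)$-linear graph $G$ having at least $t$ different valencies.
   Context: All graphs are finite and simple. Let $G$ be a graph with $(0,1)$-adjacency matrix $A$, let $\mathbf{j}$ be the all-ones vector, and let $\mathbf{d}:=A\mathbf{j}$ be the vector of valencies (degrees). For real numbers $\alpha,\beta$, the graph $G$ is called $2$-walk $(\alpha,\beta)$-linear if $G$ is not regular and $A\mathbf{d}=\alpha\mathbf{d}+\beta\mathbf{j}$. *)

(* Defs.v *)
From mathcomp Require Import all_boot all_order all_algebra.
From mathcomp Require Import reals.
Set Implicit Arguments.
Unset Strict Implicit.
Unset Printing Implicit Defensive.
Import GRing.Theory.
Local Open Scope ring_scope.

Record sgraph := SGraph {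
  vertex :> finType;
  adj : rel vertex;
  adj_sym : symmetric adj;
  adj_irr : irreflexive adj
}.

(* Rows and columns are indexed by the vertices through the canonical
   enumeration [enum_val : 'I_#|G| -> G]. *)
Definition adj_mx (R : realType) (G : sgraph) : 'M[R]_#|G| :=
  \matrix_(i, j) (adj (enum_val i) (enum_val j))%:R.

Definition ones_vec (R : realType) (G : sgraph) : 'cV[R]_#|G| := const_mx 1.

Definition valency_vec (R : realType) (G : sgraph) : 'cV[R]_#|G| :=
  adj_mx R G *m ones_vec R G.

Definition valency (G : sgraph) (x : G) : nat := #|[set y | adj x y]|.

Lemma valency_vecE (R : realType) (G : sgraph) (i : 'I_#|G|) :
  valency_vec R G i 0 = (valency (enum_val i))%:R.
Proof.
rewrite /valency -sum1dep_card big_mkcond /= natr_sum mxE.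
rewrite (reindex_onto (@enum_val G predT) enum_rank) /=; last first.
  by move=> x _; rewrite enum_rankK.
apply: eq_big => [j|j _]; first by rewrite enum_valK eqxx.
by rewrite !mxE mulr1; case: (adj _ _).
Qed.

(* The empty graph is regular. *)
Definition regular (G : sgraph) : Prop :=
  exists k : nat, forall x : G, valency x = k.

Definition two_walk_linear (R : realType) (alpha beta : R) (G : sgraph) : Prop :=
  ~ regular G /\
  adj_mx R G *m valency_vec R G
    = alpha *: valency_vec R G + beta *: ones_vec R G.

Definition valencies (G : sgraph) : seq nat := undup [seq valency x | x : G].

(* Main.v *)
Require Import Defs.
From mathcomp Require Import all_boot all_order all_algebra.
From mathcomp Require Import reals.

(** The graphs below satisfy [A d = l d], a condition stable under disjoint
    union.  Let every vertex of the side of size [r] of the complete bipartite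
    graph K(c, r) carry [l - c] extra pendant vertices.  Its valencies are [r]
    on the side of size [c], [l] on the other side and [1] at the pendant
    vertices, and [A d = l d] reduces to [c r + (l - c) = l^2], that is
    [c (r - 1) = l (l - 1)].  With [l = 2^t] this is solved by [c = 2^k] and
    [r = 1 + 2^(t - k) (2^t - 1)] for each [k <= t], so the disjoint union over
    [k] has at least [t + 1] valencies. *)

Set Implicit Arguments.
Unset Strict Implicit.
Unset Printing Implicit Defensive.

(** This is A d = l d read vertex by vertex in [nat], so the constructions below only count
    neighbours; [harmonic_walk] carries it to the reals. *)
Definition harmonic (l : nat) (G : sgraph) :=
  forall x : G, \sum_(y | adj x y) valency y = l * valency x.

Lemma valency_sum (G : sgraph) (x : G) : valency x = \sum_(y | adj x y) 1.
Proof. by rewrite /valency -sum1dep_card. Qed.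

Lemma harmonic_walk (R : realType) (l : nat) (G : sgraph) :
  harmonic l G ->
  (adj_mx R G *m valency_vec R G
     = l%:R *: valency_vec R G + 0 *: ones_vec R G)%R.
Proof.
move=> hG; apply/matrixP=> i j.
rewrite ord1 GRing.scale0r GRing.addr0 [LHS]mxE [RHS]mxE valency_vecE.
rewrite -GRing.natrM -hG [in RHS]big_mkcond GRing.natr_sum.
rewrite (reindex_onto (@enum_val G predT) enum_rank) /=; last first.
  by move=> x _; rewrite enum_rankK.
apply: eq_big => [k|k _]; first by rewrite enum_valK eqxx.
by rewrite valency_vecE mxE; case: (adj _ _); rewrite ?GRing.mul1r ?GRing.mul0r.
Qed.

Section DisjointUnion.
Variables (I : finType) (H : I -> sgraph).

Definition dunion_rel : rel {i : I & H i} :=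
  fun u v => (tag u == tag v) && adj (tagged u) (tagged_as u v).

Lemma dunion_sym : symmetric dunion_rel.
Proof.
move=> [i x] [j y]; rewrite /dunion_rel /= eq_sym.
by case: eqP => //= eji; case: i / eji x => x; rewrite !tagged_asE adj_sym.
Qed.

Lemma dunion_irr : irreflexive dunion_rel.
Proof. by move=> [i x]; rewrite /dunion_rel eqxx tagged_asE adj_irr. Qed.

Definition dunion : sgraph := SGraph dunion_sym dunion_irr.

(** Neighbours never leave the component. [F] is arbitrary because the constant 1 gives the
    valencies and [valency] gives harmonicity. *)
Lemma sum_adj_dunion (F : dunion -> nat) (i : I) (x : H i) :
  \sum_(v : dunion | adj (Tagged H x : dunion) v) F v
    = \sum_(y | adj x y) F (Tagged H y).
Proof.
rewrite (eq_bigl (fun v : dunion => (tag v == i) &&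
  adj x (tagged_as (Tagged H x) v))); last by move=> v; rewrite eq_sym.
(* [Q] makes adjacency a predicate on every component, as [sig_big_dep] requires. Off component [i]
   the cast falls back on [x], but the test on the tag discards those terms. *)
pose Q j (y : H j) := adj x (tagged_as (Tagged H x) (Tagged H y)).
rewrite (eq_bigl (fun v : dunion => (tag v == i) && Q (tag v) (tagged v))); last first.
  by case.
rewrite (eq_bigr (fun v : dunion => F (Tagged H (tagged v)))); last by case.
rewrite -(sig_big_dep (fun j => j == i) Q (fun j y => F (Tagged H y))).
by rewrite big_pred1_eq; apply: eq_bigl => y; rewrite /Q tagged_asE.
Qed.

Lemma valency_dunion (i : I) (x : H i) :
  valency (Tagged H x : dunion) = valency x.
Proof. by rewrite !valency_sum sum_adj_dunion. Qed.

Lemma harmonic_dunion (l : nat) :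
  (forall i, harmonic l (H i)) -> harmonic l dunion.
Proof.
move=> hH [i x]; rewrite sum_adj_dunion valency_dunion -hH.
by apply: eq_bigr => y _; rewrite valency_dunion.
Qed.

End DisjointUnion.

Section PendantBipartite.
Variables c r p : nat.

(* [inl i] and [inr (j, None)] are the two sides of K(c, r), and
   [inr (j, Some s)] are the pendant vertices at [inr (j, None)]. *)
Definition pendant_rel : rel ('I_c + 'I_r * option 'I_p) :=
  fun u v => match u, v with
  | inl _, inr (_, None) | inr (_, None), inl _ => true
  | inr (j, None), inr (j', Some _) | inr (j, Some _), inr (j', None) => j == j'
  | _, _ => false
  end.

Lemma pendant_sym : symmetric pendant_rel.
Proof. by move=> [i|[j [s|]]] [i'|[j' [s'|]]] //=; rewrite eq_sym. Qed.

Lemma pendant_irr : irreflexive pendant_rel.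
Proof. by move=> [i|[j [s|]]]. Qed.

Definition pendant_graph : sgraph := SGraph pendant_sym pendant_irr.

Lemma sum_pendant_graph (F : pendant_graph -> nat) :
  \sum_v F v = \sum_i F (inl i)
    + \sum_j (F (inr (j, None)) + \sum_s F (inr (j, Some s))).
Proof.
rewrite big_sumType /=; congr (_ + _).
rewrite (eq_bigr (fun q => F (inr (q.1, q.2)))); last by case.
rewrite -(pair_bigA _ (fun j o => F (inr (j, o)))) /=.
apply: eq_bigr => j _; rewrite (bigD1 None) //=; congr (_ + _).
rewrite (reindex_omap Some id) /= => [|[]] //.
by apply: eq_bigl => s; rewrite eqxx.
Qed.

Lemma sum_adj_core (F : pendant_graph -> nat) (i : 'I_c) :
  \sum_(v | adj (inl i : pendant_graph) v) F v = \sum_j F (inr (j, None)).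
Proof.
rewrite big_mkcond sum_pendant_graph /= big1_eq add0n.
by apply: eq_bigr => j _; rewrite big1_eq addn0.
Qed.

Lemma sum_adj_hub (F : pendant_graph -> nat) (j : 'I_r) :
  \sum_(v | adj (inr (j, None) : pendant_graph) v) F v
    = \sum_i F (inl i) + \sum_s F (inr (j, Some s)).
Proof.
rewrite big_mkcond sum_pendant_graph /=; congr (_ + _).
rewrite (bigD1 j) //= eqxx [X in _ + X]big1 ?addn0 // => j' /negPf.
by rewrite eq_sym => ->; rewrite big1_eq.
Qed.

Lemma sum_adj_pendant (F : pendant_graph -> nat) (j : 'I_r) (s : 'I_p) :
  \sum_(v | adj (inr (j, Some s) : pendant_graph) v) F v = F (inr (j, None)).
Proof.
rewrite big_mkcond sum_pendant_graph /= big1_eq add0n.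
rewrite (bigD1 j) //= eqxx [X in _ + X]big1 => [|j' /negPf].
  by rewrite big1_eq !addn0.
by rewrite eq_sym => ->; rewrite big1_eq.
Qed.

Lemma valency_core (i : 'I_c) : valency (inl i : pendant_graph) = r.
Proof. by rewrite valency_sum sum_adj_core sum1_card card_ord. Qed.

Lemma valency_hub (j : 'I_r) :
  valency (inr (j, None) : pendant_graph) = c + p.
Proof. by rewrite valency_sum sum_adj_hub !sum1_card !card_ord. Qed.

Lemma valency_pendant (j : 'I_r) (s : 'I_p) :
  valency (inr (j, Some s) : pendant_graph) = 1.
Proof. by rewrite valency_sum sum_adj_pendant. Qed.

(** Write l = c + p. A core vertex sees r hubs of valency l, and a pendant vertex sees one hub; only
    at a hub, whose neighbours sum to c r + p, is the equation used. *)
Lemma harmonic_pendant_graph :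
  c * r + p = (c + p) ^ 2 -> harmonic (c + p) pendant_graph.
Proof.
move=> crp [i|[j [s|]]].
- rewrite sum_adj_core valency_core (eq_bigr _ (fun j _ => valency_hub j)).
  by rewrite sum_nat_const card_ord mulnC.
- by rewrite sum_adj_pendant valency_pendant valency_hub muln1.
- rewrite sum_adj_hub valency_hub (eq_bigr _ (fun i _ => valency_core i)).
  rewrite (eq_bigr _ (fun s _ => valency_pendant j s)).
  by rewrite !sum_nat_const !card_ord muln1 crp.
Qed.

End PendantBipartite.

Definition core_valency (t k : nat) : nat := (2 ^ (t - k) * (2 ^ t).-1).+1.

Definition power_graph (t : nat) (k : 'I_t.+1) : sgraph :=
  pendant_graph (2 ^ k) (core_valency t k) (2 ^ t - 2 ^ k).

Lemma harmonic_power_graph (t : nat) (k : 'I_t.+1) :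
  harmonic (2 ^ t) (power_graph k).
Proof.
have lekt : k <= t by rewrite -ltnS.
have eqt : 2 ^ k + (2 ^ t - 2 ^ k) = 2 ^ t by rewrite subnKC // leq_exp2l.
rewrite -[X in harmonic X _]eqt; apply: harmonic_pendant_graph.
(* The left side becomes 2^k + 2^t (2^t - 1) + (2^t - 2^k), where the outer terms add up to 2^t. *)
rewrite eqt /core_valency mulnS mulnA -expnD subnKC // addnAC eqt.
by rewrite -mulnS prednK ?expn_gt0 // mulnn.
Qed.

(** For t > 0 the factor 2^t - 1 is positive and cancels; then t - k is determined, and k <= t
    recovers k despite truncated subtraction. *)
Lemma core_valency_inj (t : nat) :
  0 < t -> injective (fun k : 'I_t.+1 => core_valency t k).
Proof.
move=> t_gt0 k k' [] /eqP.
have lt1t : 1 < 2 ^ t by rewrite -{1}(expn0 2) ltn_exp2l.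
rewrite eqn_pmul2r -?subn1 ?subn_gt0 // eqn_exp2l // => /eqP eqk.
have lekt (i : 'I_t.+1) : i <= t by rewrite -ltnS.
by apply: val_inj; rewrite /= -(subKn (lekt k)) eqk subKn.
Qed.

Theorem corollary3p5 (R : realType) (t : nat) (ht : 1 <= t) :
  exists (alpha beta : R) (G : sgraph),
    two_walk_linear alpha beta G /\ t <= size (valencies G).
Proof.
pose G := dunion (@power_graph t).
have core0 (k : 'I_t.+1) : 0 < 2 ^ k by rewrite expn_gt0.
pose core (k : 'I_t.+1) : G :=
  Tagged (@power_graph t) (inl (Ordinal (core0 k)) : power_graph k).
have valE k : valency (core k) = core_valency t k.
  by rewrite valency_dunion valency_core.
exists (2 ^ t)%:R%R, 0%R, G; split; first split.
(* Regularity would equate the core valencies for k = 0 and k = t, forcing t = 0. *)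
- move=> [d regG]; have : ord0 = ord_max :> 'I_t.+1.
    by apply: (core_valency_inj ht); rewrite -!valE !regG.
  by move/(congr1 val) => /= t0; rewrite -t0 in ht.
- by apply/harmonic_walk/harmonic_dunion/harmonic_power_graph.
(* The core valencies alone form a duplicate-free list of length t + 1. *)
apply: (@leq_trans (size (codom (fun k : 'I_t.+1 => core_valency t k)))).
  by rewrite size_codom card_ord.
apply: uniq_leq_size => [|d /codomP[k ->]].
  by apply/injectiveP/core_valency_inj.
by rewrite mem_undup -valE image_f.
Qed.
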